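(* In the C-CPPG, if $(L,T)$ is a feasible pair with $T>1$, then $$(T-1)\,f_{LB-C}\Big(\frac{L}{T-1}\Big)\ \ge\ N-2k^2 .$$ Moreover, the boundary of this inequality, $(T-1)f_{LB-C}\big(\frac{L}{T-1}\big)=N-2k^2$, is a polyline connecting $$\Big(\frac{N^*}{f(1)},\frac{N^*}{f(1)}\Big)\to\Big(\frac{2N^*}{f(2)},\frac{N^*}{f(2)}\Big)\to\cdots\to\Big(\frac{iN^*}{f(i)},\frac{N^*}{f(i)}\Big)\to\cdots\to\Big(\frac{2kN^*}{f(2k)},\frac{N^*}{f(2k)}\Big)\to\Big(\infty,\frac{N^*}{f(2k)}\Big)$$ in the $(L,T)$ plane, where $N^*=N-2k^2$.
   Context: Let $m\ge n>0$ be integers, $D=\{(x,y)\in\mathbb{R}^2: 0\le x\le n,\ 0\le y\le m\}$, $N=mn$ the area of $D$, and $D_{int}=D\cap\mathbb{Z}^2$. The unit grid is the graph on $D_{int}$ in which points at distance 1 are joined by an edge of length 1. Distances are measured in the $\ell_1$ norm. C-CPPG (continuous covering path problem on a grid), with coverage radius $k$ a positive integer: one selects a set of stops $V_1\subseteq D_{int}$ such that every point of $D$ is within distance $k$ of some stop, and a path in the grid connecting the stops (a covering path). The path length is the total length of its edges and the stop count is the number of stops. A pair $(L,T)$ is feasible if there is a covering path with at most $T$ stops and path length at most $L$. The function $f$ is $f(d)=d\big(2k-\frac d2\big)$ for $d\in(0,2k]$ and $f(d)=2k^2$ for $d\in(2k,\infty)$. The function $f_{LB-C}$ is the piecewise-linear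 function connecting $(1,f(1))\to(2,f(2))\to\cdots\to(2k,f(2k))\to(\infty,f(2k))$, i.e. $f_{LB-C}(d)=(t+1-d)f(t)+(d-t)f(t+1)$ if $d\in[t,t+1)$ with $t\in\{1,\dots,2k-1\}$, and $f_{LB-C}(d)=2k^2$ if $d\ge 2k$.
   Formalization: The polyline with the printed vertices is shown to be the boundary in the (L, T−1) plane rather than the (L,T) plane, where the claim fails, and N* > 0 is assumed for that part, since for N* ≤ 0 the equality set is empty. *)

(* Defs.v *)
From HB Require Import structures.
From mathcomp Require Import all_boot all_order all_algebra.
From mathcomp Require Import all_classical all_reals.

Set Implicit Arguments.
Unset Strict Implicit.
Unset Printing Implicit Defensive.

Import Order.TTheory GRing.Theory Num.Theory.
Local Open Scope classical_set_scope.
Local Open Scope ring_scope.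

Definition region (R : realType) (m n : nat) : set (R * R) :=
  [set P | 0 <= P.1 <= n%:R /\ 0 <= P.2 <= m%:R].

(* The integer points of the region: abscissa in 0..n, ordinate in 0..m. *)
Definition gridpt (m n : nat) : finType := ('I_n.+1 * 'I_m.+1)%type.

Definition gridpt_val (R : realType) (m n : nat) (v : gridpt m n) : R * R :=
  ((v.1 : nat)%:R, (v.2 : nat)%:R).

Definition l1dist (R : realType) (P Q : R * R) : R :=
  `|P.1 - Q.1| + `|P.2 - Q.2|.

Definition grid_edge (R : realType) (m n : nat) : rel (gridpt m n) :=
  fun u v => l1dist (gridpt_val R u) (gridpt_val R v) == 1.

Definition covers (R : realType) (m n k : nat) (V : {set gridpt m n}) : Prop :=
  forall P, region m n P ->
    exists2 v, v \in V & l1dist P (gridpt_val R v) <= k%:R.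

(* The path x :: p may revisit points and need not start or end at a stop.
   Every edge has length 1, so the length of the path is size p. *)
Definition covering_path (R : realType) (m n k : nat) (V : {set gridpt m n})
    (x : gridpt m n) (p : seq (gridpt m n)) : Prop :=
  [/\ covers R k V, path (@grid_edge R m n) x p
    & {subset V <= x :: p}].

Definition feasible (R : realType) (m n k : nat) (L T : R) : Prop :=
  exists (V : {set gridpt m n}) (x : gridpt m n) (p : seq (gridpt m n)),
    [/\ covering_path R k V x p, #|V|%:R <= T & (size p)%:R <= L].

Definition f (R : realType) (k : nat) (d : R) : R :=
  if d <= 2 * k%:R then d * (2 * k%:R - d / 2) else 2 * k%:R ^+ 2.

(* The interpolant is meant for d >= 1.  On 0 <= d < 1 the formula reads t = 0
   with f k 0 = 0, i.e. it extends the interpolant by the segment from (0, 0)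
   to (1, f k 1). *)
Definition f_LBC (R : realType) (k : nat) (d : R) : R :=
  if 2 * k%:R <= d then 2 * k%:R ^+ 2
  else let t := Num.truncn d in
       (t.+1%:R - d) * f k t%:R + (d - t%:R) * f k t.+1%:R.

Definition Nstar (R : realType) (m n k : nat) : R :=
  (m * n)%:R - 2 * k%:R ^+ 2.

(* Points (L, T) with L / (T - 1) in the domain [1, +oo[ of the interpolant. *)
Definition boundary (R : realType) (m n k : nat) : set (R * R) :=
  [set P | [/\ 1 < P.2, 1 <= P.1 / (P.2 - 1)
    & (P.2 - 1) * f_LBC k (P.1 / (P.2 - 1)) = Nstar R m n k]].

(* Vertices are points of the (L, T - 1) plane: the equality holds at
   L / (T - 1) = i exactly when T - 1 = Nstar / f k i. *)
Definition vertex (R : realType) (m n k i : nat) : R * R :=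
  (i%:R * Nstar R m n k / f k i%:R, Nstar R m n k / f k i%:R).

Definition segment (R : realType) (A B : R * R) : set (R * R) :=
  [set P | exists2 s : R, 0 <= s <= 1
    & P = ((1 - s) * A.1 + s * B.1, (1 - s) * A.2 + s * B.2)].

Definition polyline (R : realType) (m n k : nat) : set (R * R) :=
  (\bigcup_(i in [set i | (1 <= i < 2 * k)%N])
      segment (vertex R m n k i) (vertex R m n k i.+1))
  `|` [set P | (vertex R m n k (2 * k)).1 <= P.1
               /\ P.2 = (vertex R m n k (2 * k)).2].

(* Main.v *)
Require Import Defs.
From mathcomp Require Import all_boot all_order all_algebra.
From mathcomp Require Import all_classical all_reals.
From mathcomp Require Import zify ring lra.

Set Implicit Arguments.
Unset Strict Implicit.
Unset Printing Implicit Defensive.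

Import Order.TTheory GRing.Theory Num.Theory.
Local Open Scope classical_set_scope.
Local Open Scope ring_scope.

(* Area is counted through midpoints of unit grid edges, each worth 1/2: the
   region contains 2 m n of them (omitting its top and right sides).  After
   rotation by 45 degrees the l1 ball of radius k at a grid point is a
   2k x 2k square of cells centred at such midpoints, and two balls at l1
   distance d share at least (2k - d)^2 cells, so a stop at distance d from the
   previous one covers at most 4k^2 - (2k - d)^2 = 2 f(d) new midpoints.  Summing
   along the path gives N - 2k^2 <= sum_i f(d_i) with integers d_i, at most
   T - 1 of them and of total at most L.  The piece of f_LBC containing
   L / (T - 1) lies on a line that dominates f at all integers and has
   nonnegative slope and intercept, which bounds the sum.  Each such line, with
   L / (T - 1) as argument, turns into a straight line in the (L, T - 1) plane,
   hence the polyline. *)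

Lemma sumn_pairmap_subseq_path (T : eqType) (e : rel T) (dist : T -> T -> nat) :
  (forall x, dist x x = 0%N) ->
  (forall x y z, (dist x z <= dist x y + dist y z)%N) ->
  (forall x y, e x y -> (dist x y <= 1)%N) ->
  forall (p s : seq T) (x y : T), path e x p -> subseq (y :: s) (x :: p) ->
    (dist x y + sumn (pairmap dist y s) <= size p)%N.
Proof.
move=> dist0 dist_tri e_dist; elim=> [|z p IHp] s x y /=.
  by move=> _; case: (y =P x) => [->|] //; case: s => //=; rewrite dist0.
case/andP=> /e_dist xz zp; case: (y =P x) => [->{y}|_].
  case: s => [|y s] sub_s; first by rewrite dist0.
  have /= := IHp s z y zp sub_s; have := dist_tri x z y.
  by rewrite dist0 /=; lia.
by move=> /(IHp s z y zp); have := dist_tri x z y; lia.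
Qed.

Lemma card_bigcup_pairmap (T I : finType) (B : I -> {set T}) (s : seq I) (y : I) :
  (#|\bigcup_(z <- y :: s) B z|
     <= #|B y| + sumn (pairmap (fun v w => #|B w :\: B v|) y s))%N.
Proof.
elim: s y => [|z s IHs] y; first by rewrite big_seq1 addn0.
rewrite big_cons; set U := \bigcup_(w <- z :: s) B w.
have := IHs z; rewrite -/U /=.
have zU : B z \subset U by rewrite /U big_cons finset.subsetUl.
have sub : B y :|: U \subset (B y :|: (B z :\: B y)) :|: (U :\: B z).
  by apply/fintype.subsetP=> w; rewrite !inE; case: (w \in B y); case: (w \in B z).
have := subset_leq_card sub; have := subset_leq_card zU.
have := cardsDS zU.
have [+ _] := leq_card_setU (B y :|: (B z :\: B y)) (U :\: B z).
have [+ _] := leq_card_setU (B y) (B z :\: B y).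
by move: (sumn _) => c; lia.
Qed.

Lemma card_ord_itv (M a b : nat) : (b <= M)%N ->
  #|[set i : 'I_M | (a <= i < b)%N]%SET| = (b - a)%N.
Proof.
move=> le_bM; rewrite cardsE -sum1_card.
rewrite -(big_mkord (fun i => (a <= i < b)%N) (fun=> 1%N)).
rewrite sum1_count -size_filter.
have -> : [seq i <- index_iota 0 M | (a <= i < b)%N] = index_iota a b.
  apply: (@irr_sorted_eq _ ltn ltn_trans ltnn).
  - by apply: sorted_filter (iota_ltn_sorted _ _); apply: ltn_trans.
  - exact: iota_ltn_sorted.
  - by move=> i; rewrite mem_filter !mem_index_iota; lia.
by rewrite size_iota.
Qed.

Definition grid_dist (m n : nat) (u v : gridpt m n) : nat :=
  ((u.1 - v.1) + (v.1 - u.1) + ((u.2 - v.2) + (v.2 - u.2)))%N.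

Lemma natr_dist (R : realType) (a b : nat) :
  `|a%:R - b%:R| = ((a - b) + (b - a))%:R :> R.
Proof.
have [le_ab|/ltnW le_ba] := leqP a b.
  by rewrite distrC ger0_norm ?subr_ge0 ?ler_nat // -natrB //; congr _%:R; lia.
by rewrite ger0_norm ?subr_ge0 ?ler_nat // -natrB //; congr _%:R; lia.
Qed.

Lemma grid_edgeE (R : realType) (m n : nat) (u v : gridpt m n) :
  grid_edge R u v = (grid_dist u v == 1%N).
Proof.
by rewrite /grid_edge /l1dist /= !natr_dist -natrD (eqr_nat R _ 1).
Qed.

(* In the coordinates x + y and x + (m - y) an l1 ball is a square.  A cell
   (p, q) of the 45-degree lattice stands for the midpoint of a unit edge of the
   grid; indices are shifted by k to avoid negative numbers. *)
Definition ball_cells (m n k : nat) (v : gridpt m n) :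
    {set 'I_(n + m + 2 * k) * 'I_(n + m + 2 * k)} :=
  finset.setX [set p : 'I_(n + m + 2 * k) | (v.1 + v.2 <= p < v.1 + v.2 + 2 * k)%N]%SET
       [set q : 'I_(n + m + 2 * k) |
         (v.1 + (m - v.2) <= q < v.1 + (m - v.2) + 2 * k)%N]%SET.

Lemma card_ball_cells (m n k : nat) (v : gridpt m n) :
  #|ball_cells k v| = (4 * k ^ 2)%N.
Proof.
have := ltn_ord v.1; have := ltn_ord v.2 => *.
by rewrite cardsX !card_ord_itv; lia.
Qed.

Lemma card_ball_cellsD (m n k : nat) (v w : gridpt m n) :
  (#|ball_cells k w :\: ball_cells k v|
     <= 4 * k ^ 2 - (2 * k - grid_dist v w) ^ 2)%N.
Proof.
rewrite cardsD card_ball_cells leq_sub2l //.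
have v1 := ltn_ord v.1; have v2 := ltn_ord v.2.
have w1 := ltn_ord w.1; have w2 := ltn_ord w.2.
pose M := (n + m + 2 * k)%N.
pose I (a b : nat) := [set p : 'I_M | (maxn a b <= p < minn a b + 2 * k)%N]%SET.
have sub : finset.setX (I (w.1 + w.2)%N (v.1 + v.2)%N)
                (I (w.1 + (m - w.2))%N (v.1 + (m - v.2))%N)
           \subset ball_cells k w :&: ball_cells k v.
  apply/fintype.subsetP=> -[p q]; rewrite !inE /=.
  move: (p : nat) (q : nat) (w.1 : nat) (w.2 : nat) (v.1 : nat) (v.2 : nat).
  by clear; lia.
apply: leq_trans (subset_leq_card sub).
rewrite cardsX !card_ord_itv /M; try lia.
by rewrite /grid_dist -mulnn; apply: leq_mul; lia.
Qed.

(* The midpoint of the horizontal (b = false) or vertical (b = true) unit edge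
   issued from (i, j).  Leaving out the top and right sides of the region makes
   their number exactly twice its area. *)
Definition edge_midpoint (R : realType) (b : bool) (i j : nat) : R * R :=
  (i%:R + (~~ b)%:R / 2, j%:R + b%:R / 2).

Lemma edge_midpoint_ball (R : realType) (m n k : nat) (b : bool) (i j : nat)
    (v : gridpt m n) : (j < m)%N ->
  l1dist (edge_midpoint R b i j) (gridpt_val R v) <= k%:R ->
  (v.1 + v.2 <= i + j + k < v.1 + v.2 + 2 * k)%N &&
  (v.1 + (m - v.2) <= i + (m - j) - b + k < v.1 + (m - v.2) + 2 * k)%N.
Proof.
move=> lt_jm; rewrite /l1dist /=.
case: v => x y /=; have lt_y := ltn_ord y.
set X : R := _ - _; set Y : R := _ - _ => XY.
have X1 := ler_norm X; have X2 := ler_norm (- X).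
have Y1 := ler_norm Y; have Y2 := ler_norm (- Y).
rewrite !normrN in X2 Y2.
have h1 : ((2 * (i + j) + 1)%:R <= (2 * (k + x + y))%:R :> R).
  rewrite !(natrD, natrM); move: XY X1 X2 Y1 Y2; rewrite /X /Y; case: b {X Y} => /=; lra.
have h2 : ((2 * (x + y))%:R <= (2 * (i + j + k) + 1)%:R :> R).
  rewrite !(natrD, natrM); move: XY X1 X2 Y1 Y2; rewrite /X /Y; case: b {X Y h1} => /=; lra.
have h3 : ((2 * (i + y) + 1)%:R <= (2 * (k + x + j + b))%:R :> R).
  rewrite !(natrD, natrM); move: XY X1 X2 Y1 Y2; rewrite /X /Y; case: b {X Y h1 h2} => /=; lra.
have h4 : ((2 * (x + j + b))%:R <= (2 * (i + y + k) + 1)%:R :> R).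
  rewrite !(natrD, natrM); move: XY X1 X2 Y1 Y2; rewrite /X /Y; case: b {X Y h1 h2 h3} => /=; lra.
by rewrite !ler_nat in h1 h2 h3 h4; clear -h1 h2 h3 h4 lt_y lt_jm; case: b h3 h4 => /=; lia.
Qed.

Lemma covers_card_cells (R : realType) (m n k : nat) (V : {set gridpt m n}) :
  (0 < k)%N -> covers R k V ->
  (2 * (m * n) <= #|\bigcup_(v in V) ball_cells k v|%SET)%N.
Proof.
move=> k_gt0 covV; pose M := (n + m + 2 * k)%N.
have M_gt0 : (0 < M)%N by rewrite /M; lia.
pose toM (i : nat) : 'I_M := insubd (Ordinal M_gt0) i.
have toM_val i : (i < M)%N -> toM i = i :> nat by move=> lt_iM; rewrite insubdK.
pose h (s : bool * ('I_n * 'I_m)) : 'I_M * 'I_M :=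
  let: (b, (i, j)) := s in (toM (i + j + k)%N, toM (i + (m - j) - b + k)%N).
have h1 b (i : 'I_n) (j : 'I_m) : (h (b, (i, j))).1 = (i + j + k)%N :> nat.
  by apply: toM_val; rewrite /M; have := ltn_ord i; have := ltn_ord j; lia.
have h2 b (i : 'I_n) (j : 'I_m) :
    (h (b, (i, j))).2 = (i + (m - j) - b + k)%N :> nat.
  by apply: toM_val; rewrite /M; have := ltn_ord i; have := ltn_ord j; lia.
have h_inj : injective h.
  move=> [b [i j]] [b' [i' j']] eq_h.
  have := h1 b i j; have := h2 b i j; rewrite eq_h h1 h2 => e2 e1.
  have lt_j := ltn_ord j; have lt_j' := ltn_ord j'.
  have [eb ei ej] : [/\ b = b', i = i' :> nat & j = j' :> nat].
    by case: b e2 {eq_h}; case: b' => /= e2; split=> //; lia.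
  by rewrite eb (val_inj ei) (val_inj ej).
have <- : #|[set h s | s in [set: bool * ('I_n * 'I_m)]]%SET| = (2 * (m * n))%N.
  by rewrite card_imset // cardsT !card_prod card_bool !card_ord (mulnC n).
apply/subset_leq_card/fintype.subsetP => _ /imsetP[[b [i j]] _ ->].
have lt_i := ltn_ord i; have lt_j := ltn_ord j.
have [|v vV cov] := covV (edge_midpoint R b i j).
  have : (i%:R + 1 <= n%:R :> R) /\ (j%:R + 1 <= m%:R :> R).
    by rewrite !natr1 !ler_nat.
  have := ler0n R i; have := ler0n R j.
  by rewrite /region /=; case: (b) => /= ? ? [? ?]; split; apply/andP; split; lra.
apply/finset.bigcupP; exists v => //; rewrite inE.
by have := edge_midpoint_ball lt_j cov; rewrite !inE h1 h2.
Qed.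

Lemma grid_dist_triangle (m n : nat) (u v w : gridpt m n) :
  (grid_dist u w <= grid_dist u v + grid_dist v w)%N.
Proof. rewrite /grid_dist; lia. Qed.

Lemma covering_path_gaps (R : realType) (m n k : nat) (V : {set gridpt m n})
    (x : gridpt m n) (p : seq (gridpt m n)) :
  (0 < k)%N -> covering_path R k V x p ->
  exists ds : seq nat, [/\ (size ds < #|V|)%N, (sumn ds <= size p)%N
    & (2 * (m * n) <=
        4 * k ^ 2 + \sum_(d <- ds) (4 * k ^ 2 - (2 * k - d) ^ 2))%N].
Proof.
move=> k_gt0 [covV path_p subV].
pose s := undup [seq v <- x :: p | v \in V].
have s_mem v : v \in s = (v \in V).
  by rewrite mem_undup mem_filter; apply: andb_idr; apply: subV.
have size_s : size s = #|V|.
  by rewrite -(eq_card s_mem) (card_uniqP (undup_uniq _)).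
have sub_s : subseq s (x :: p).
  exact: subseq_trans (undup_subseq _) (filter_subseq _ _).
have cells := covers_card_cells k_gt0 covV.
have sE : (\bigcup_(v in V) ball_cells k v = \bigcup_(v <- s) ball_cells k v)%SET.
  rewrite -(eq_bigl _ _ s_mem) big_uniq ?undup_uniq //.
have [v0 v0V _] : exists2 v, v \in V & l1dist (0, 0) (gridpt_val R v) <= k%:R.
  by apply: covV; rewrite /region /= lexx !ler0n.
rewrite -s_mem in v0V.
case: s s_mem size_s sub_s sE v0V => [//|y s] _ size_s sub_s sE _.
exists (pairmap (@grid_dist m n) y s); split.
- by rewrite size_pairmap -size_s.
- apply: leq_trans (leq_addl _ _) _.
  apply: (sumn_pairmap_subseq_path _ (@grid_dist_triangle m n) _ path_p sub_s).
    by move=> u; rewrite /grid_dist !subnn.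
  by move=> u v; rewrite grid_edgeE => /eqP->.
- rewrite sE in cells; apply: leq_trans cells _.
  apply: leq_trans (card_bigcup_pairmap _ _ _) _.
  rewrite card_ball_cells leq_add2l.
  elim: s y {size_s sub_s sE} => [|z s IHs] y; first by rewrite big_nil.
  by rewrite /= big_cons leq_add ?card_ball_cellsD.
Qed.

Lemma f_natE (R : realType) (k d : nat) :
  2 * f k d%:R = (4 * k ^ 2 - (2 * k - d) ^ 2)%:R :> R.
Proof.
rewrite /f -natrM ler_nat; case: leqP => [le_d|/ltnW lt_d].
  have -> : (4 * k ^ 2 = (2 * k) ^ 2)%N by rewrite expnMn.
  rewrite natrB; last by rewrite leq_exp2r // leq_subr.
  by rewrite !natrX natrB // natrM; field.
have -> : (2 * k - d = 0)%N by lia.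
by rewrite exp0n // subn0 natrM natrX; ring.
Qed.

Lemma f_LBC_itv (R : realType) (k t : nat) (x : R) : (t < 2 * k)%N ->
  t%:R <= x <= t.+1%:R ->
  f_LBC k x = (t.+1%:R - x) * f k t%:R + (x - t%:R) * f k t.+1%:R.
Proof.
move=> lt_t /andP[le_tx]; rewrite le_eqVlt => /predU1P[->|lt_xt].
  rewrite subrr mul0r add0r -natrB // subSnn mul1r /f_LBC.
  rewrite -natrM ler_nat; case: leqP => [le_kt|lt_tk].
    have -> : t.+1 = (2 * k)%N by lia.
    by rewrite /f natrM lexx; field.
  rewrite (@Num.Theory.truncn_def _ _ t.+1); last by rewrite lexx ltr_nat ltnSn.
  by rewrite subrr mul0r addr0 -natrB // subSnn mul1r.
have lt_x : x < 2 * k%:R by rewrite (lt_le_trans lt_xt) // -natrM ler_nat.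
by rewrite /f_LBC leNgt lt_x /= (@Num.Theory.truncn_def _ _ t) // le_tx.
Qed.

Lemma f_LBC_ge (R : realType) (k : nat) (x : R) : 2 * k%:R <= x ->
  f_LBC k x = 2 * k%:R ^+ 2.
Proof. by rewrite /f_LBC => ->. Qed.

Lemma f_small (R : realType) (k d : nat) : (d <= 2 * k)%N ->
  f k d%:R = d%:R * (2 * k%:R - d%:R / 2) :> R.
Proof. by rewrite /f -natrM ler_nat => ->. Qed.

Lemma f_gt0 (R : realType) (k d : nat) : (0 < d <= 2 * k)%N ->
  0 < f k d%:R :> R.
Proof.
case/andP=> d_gt0 le_d; rewrite f_small //.
have : 1 <= d%:R :> R by rewrite ler1n.
have : d%:R <= 2 * k%:R :> R by rewrite -natrM ler_nat.
by move=> ? ?; apply: mulr_gt0; lra.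
Qed.

Lemma f_le_max (R : realType) (k d : nat) : f k d%:R <= 2 * k%:R ^+ 2 :> R.
Proof.
rewrite /f; case: ifP => // _.
by have := sqr_ge0 (2 * k%:R - d%:R : R); nra.
Qed.

(* For integers d <= 2k the gap is (d - t) (d - t - 1) / 2, which is negative
   only strictly between t and t + 1. *)
Lemma f_le_chord (R : realType) (k t d : nat) : (t < 2 * k)%N ->
  f k d%:R <= (t.+1%:R - d%:R) * f k t%:R + (d%:R - t%:R) * f k t.+1%:R :> R.
Proof.
move=> lt_t; rewrite (f_small _ (ltnW lt_t)) (f_small _ lt_t) -natr1.
have t_ge0 : 0 <= t%:R :> R by [].
have le_t : t%:R + 1 <= 2 * k%:R :> R by rewrite natr1 -natrM ler_nat.
have gap (y : R) : (t%:R + 1 - y) * (t%:R * (2 * k%:R - t%:R / 2)) +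
    (y - t%:R) * ((t%:R + 1) * (2 * k%:R - (t%:R + 1) / 2)) =
    y * (2 * k%:R - y / 2) + (y - t%:R) * (y - t%:R - 1) / 2.
  by field.
rewrite gap; have [le_d|lt_d] := leqP d (2 * k).
  rewrite f_small // lerDl divr_ge0 //.
  have [le_dt|lt_td] := leqP d t.
    by have : d%:R <= t%:R :> R by [rewrite ler_nat]; move=> ?; apply: mulr_le0; lra.
  have : t%:R + 1 <= d%:R :> R by rewrite natr1 ler_nat.
  by move=> ?; apply: mulr_ge0; lra.
have lt_dR : 2 * k%:R <= d%:R :> R by rewrite -natrM ler_nat ltnW.
apply: le_trans (f_le_max _ _ _) _.
nra.
Qed.

Lemma sum_f_le (R : realType) (k : nat) (ds : seq nat) (L r : R) :
  0 < r -> (size ds)%:R <= r -> (sumn ds)%:R <= L ->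
  \sum_(d <- ds) f k d%:R <= r * f_LBC k (L / r).
Proof.
move=> r_gt0 le_r le_L; set x := L / r.
have L_ge0 : 0 <= L by apply: le_trans le_L.
have Lx : L = r * x by rewrite /x mulrC divfK // gt_eqF.
have [ge_x|lt_x] := leP (2 * k%:R) x.
  have c_ge0 : 0 <= 2 * k%:R ^+ 2 :> R by rewrite mulr_ge0 ?sqr_ge0.
  rewrite f_LBC_ge //; apply: le_trans (ler_wpM2r c_ge0 le_r).
  elim: (ds) => [|d s IHs]; first by rewrite big_nil mul0r.
  by rewrite big_cons /= -natr1; have := f_le_max R k d; lra.
have x_ge0 : 0 <= x by rewrite divr_ge0 // ltW.
have := Num.Theory.truncn_itv x_ge0; set t := Num.truncn x => /andP[le_tx lt_xt].
have lt_t : (t < 2 * k)%N by rewrite -(ltr_nat R) natrM (le_lt_trans le_tx).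
rewrite (f_LBC_itv lt_t); last by rewrite le_tx ltW.
pose a : R := f k t%:R; pose b : R := f k t.+1%:R.
have sum_le : \sum_(d <- ds) f k d%:R <=
    (size ds)%:R * (t.+1%:R * a - t%:R * b) + (sumn ds)%:R * (b - a).
  elim: (ds) => [|d s IHs]; first by rewrite big_nil /= !mul0r addr0.
  rewrite big_cons /= natrD -natr1.
  by have := f_le_chord R d lt_t; rewrite -/a -/b; lra.
apply: le_trans sum_le _; rewrite -/a -/b.
have le_t : t%:R + 1 <= 2 * k%:R :> R by rewrite natr1 -natrM ler_nat.
have t_ge0 : 0 <= t%:R :> R by [].
have aE : a = t%:R * (2 * k%:R - t%:R / 2) by rewrite /a f_small // ltnW.
have bE : b = (t%:R + 1) * (2 * k%:R - (t%:R + 1) / 2).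
  by rewrite /b f_small // -natr1.
have slope : 0 <= b - a by rewrite aE bE; lra.
have icpt : 0 <= t.+1%:R * a - t%:R * b by rewrite aE bE -natr1; nra.
rewrite Lx in le_L.
have := ler_wpM2r icpt le_r; have := ler_wpM2r slope le_L; lra.
Qed.

Lemma feasible_f_LBC_ge (R : realType) (m n k : nat) (L T : R) :
  (0 < k)%N -> feasible m n k L T -> 1 < T ->
  Nstar R m n k <= (T - 1) * f_LBC k (L / (T - 1)).
Proof.
move=> k_gt0 [V [x [p [cov le_T le_L]]]] T_gt1.
have [ds [size_ds sumn_ds area]] := covering_path_gaps k_gt0 cov.
have le_ds : (size ds)%:R <= T - 1.
  by rewrite lerBrDr natr1 (le_trans _ le_T) // ler_nat.
have le_sumn : (sumn ds)%:R <= L by apply: le_trans le_L; rewrite ler_nat.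
have T1_gt0 : 0 < T - 1 by rewrite subr_gt0.
apply: le_trans (sum_f_le k T1_gt0 le_ds le_sumn).
have : (2 * (m * n))%:R <= 4 * k%:R ^+ 2 + 2 * \sum_(d <- ds) f k d%:R :> R.
  rewrite mulr_sumr (eq_bigr _ (fun d _ => f_natE R k d)).
  by rewrite -natr_sum -natrX -natrM -natrD ler_nat.
by rewrite /Nstar natrM; lra.
Qed.

Lemma boundary_sub_polyline (R : realType) (m n k : nat) (L r : R) :
  (0 < k)%N -> 0 < Nstar R m n k -> 0 < r -> 1 <= L / r ->
  r * f_LBC k (L / r) = Nstar R m n k -> polyline m n k (L, r).
Proof.
move=> k_gt0; rewrite /polyline /vertex; move: (Nstar R m n k) => N N_gt0 r_gt0.
set x := L / r => x_ge1.
have Lx : L = x * r by rewrite divfK // gt_eqF.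
have [ge_x|lt_x] := leP (2 * k%:R) x.
  have k2 : f k (2 * k)%:R = 2 * k%:R ^+ 2 :> R.
    by rewrite f_small // natrM; field.
  rewrite f_LBC_ge // => rN; right; rewrite /= k2 -rN.
  have k_neq0 : k%:R != 0 :> R by rewrite pnatr_eq0 -lt0n.
  split; last by field.
  have -> : (2 * k)%:R * (r * (2 * k%:R ^+ 2)) / (2 * k%:R ^+ 2) = (2 * k)%:R * r.
    by field.
  by rewrite Lx natrM ler_wpM2r // ltW.
have x_ge0 : 0 <= x by rewrite (le_trans ler01).
have := Num.Theory.truncn_itv x_ge0; set t := Num.truncn x => /andP[le_tx lt_xt].
have lt_t : (t < 2 * k)%N by rewrite -(ltr_nat R) natrM (le_lt_trans le_tx).
have t_gt0 : (0 < t)%N by rewrite Num.Theory.truncn_gt0.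
rewrite (f_LBC_itv lt_t); last by rewrite le_tx ltW.
have a_gt0 : 0 < f k t%:R :> R by rewrite f_gt0 // t_gt0 ltnW.
have b_gt0 : 0 < f k t.+1%:R :> R by rewrite f_gt0.
move=> rN; left; exists t; first by rewrite /= t_gt0.
move: (f k t%:R) (f k t.+1%:R) a_gt0 b_gt0 rN => a b a_gt0 b_gt0 rN.
have N_neq0 : N != 0 by rewrite gt_eqF.
pose s := (x - t%:R) * r * b / N.
have s1 : 1 - s = (t.+1%:R - x) * r * a / N.
  by rewrite /s -{1}(divff N_neq0) -mulrBl -{1}rN; congr (_ / _); ring.
have [r_ge0 N_ge0] := (ltW r_gt0, ltW N_gt0).
have [a_ge0 b_ge0] := (ltW a_gt0, ltW b_gt0).
have s_ge0 : 0 <= s by rewrite /s !mulr_ge0 ?invr_ge0 ?subr_ge0.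
have s1_ge0 : 0 <= 1 - s by rewrite s1 !mulr_ge0 ?invr_ge0 ?subr_ge0 ?(ltW lt_xt).
exists s; first by rewrite s_ge0 -subr_ge0.
have a_neq0 : a != 0 by rewrite gt_eqF.
have b_neq0 : b != 0 by rewrite gt_eqF.
rewrite /= s1 /s Lx -natr1; clearbody x t.
by congr pair; field; rewrite b_neq0 N_neq0 a_neq0.
Qed.

Lemma polyline_sub_boundary (R : realType) (m n k : nat) (L r : R) :
  (0 < k)%N -> 0 < Nstar R m n k -> polyline m n k (L, r) ->
  [/\ 0 < r, 1 <= L / r & r * f_LBC k (L / r) = Nstar R m n k].
Proof.
move=> k_gt0; rewrite /polyline /vertex; move: (Nstar R m n k) => N N_gt0.
have k_gt0R : 0 < k%:R :> R by rewrite ltr0n.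
case=> [[t /= /andP[t_gt0 lt_t]]|/=]; last first.
  have -> : f k (2 * k)%:R = 2 * k%:R ^+ 2 :> R.
    by rewrite f_small // natrM; field.
  move=> [le_L rE].
  have r_gt0 : 0 < r by rewrite rE divr_gt0 // mulr_gt0 ?exprn_gt0.
  have le_x : 2 * k%:R <= L / r.
    by rewrite ler_pdivlMr // rE mulrA -natrM.
  split=> //.
    by apply: le_trans le_x; rewrite -natrM ler1n muln_gt0.
  by rewrite f_LBC_ge // rE; field; rewrite gt_eqF.
have a_gt0 : 0 < f k t%:R :> R by rewrite f_gt0 // t_gt0 ltnW.
have b_gt0 : 0 < f k t.+1%:R :> R by rewrite f_gt0.
have := @f_LBC_itv R k t (L / r) lt_t.
move: (f k t%:R) (f k t.+1%:R) a_gt0 b_gt0 => a b a_gt0 b_gt0 fE.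
case=> s /andP[s_ge0 s_le1] [LE rE].
have a_neq0 : a != 0 by rewrite gt_eqF.
have b_neq0 : b != 0 by rewrite gt_eqF.
have A_gt0 : 0 < N / a by rewrite divr_gt0.
have B_gt0 : 0 < N / b by rewrite divr_gt0.
have r_gt0 : 0 < r.
  rewrite rE; case: (eqVneq s 0) => [->|s_neq0].
    by rewrite subr0 mul1r mul0r addr0.
  have s_gt0 : 0 < s by rewrite lt_def s_neq0.
  apply: ltr_wpDl; last exact: mulr_gt0.
  by apply: mulr_ge0; rewrite ?subr_ge0 // ltW.
have L_lo : L - t%:R * r = s * (N / b) by rewrite LE rE -natr1; ring.
have L_hi : t.+1%:R * r - L = (1 - s) * (N / a) by rewrite LE rE -natr1; ring.
have le_x : t%:R <= L / r.
  by rewrite ler_pdivlMr // -subr_ge0 L_lo mulr_ge0 // ltW.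
have x_le : L / r <= t.+1%:R.
  by rewrite ler_pdivrMr // -subr_ge0 L_hi mulr_ge0 ?subr_ge0 // ltW.
split=> //; first by apply: le_trans le_x; rewrite ler1n.
rewrite fE ?le_x //.
have -> : r * ((t.+1%:R - L / r) * a + (L / r - t%:R) * b) =
    (t.+1%:R * r - L) * a + (L - t%:R * r) * b.
  by field; rewrite gt_eqF.
by rewrite L_hi L_lo; field; rewrite b_neq0 a_neq0.
Qed.

(* MathComp(-Analysis) world.  The vertices of the polyline have T - 1 as
   second coordinate, hence the shift in the second conjunct. *)
Theorem theorem4 (R : realType) (m n k : nat)
    (n_gt0 : (0 < n)%N) (le_nm : (n <= m)%N) (k_gt0 : (0 < k)%N) :
  (forall L T : R, feasible m n k L T -> 1 < T ->
     (T - 1) * f_LBC k (L / (T - 1)) >= (m * n)%:R - 2 * k%:R ^+ 2)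
  /\
  (0 < Nstar R m n k ->
     [set (P.1, P.2 - 1) | P in @boundary R m n k] = polyline m n k).
Proof.
split=> [L T|N_gt0]; first exact: feasible_f_LBC_ge.
apply/seteqP; split=> [_ [[L T] /= [T_gt1 x_ge1 rN] <-]|[L r] Lr].
  by apply: boundary_sub_polyline => //; rewrite subr_gt0.
have [r_gt0 x_ge1 rN] := polyline_sub_boundary k_gt0 N_gt0 Lr.
exists (L, r + 1); last by rewrite /= addrK.
by rewrite /boundary /= addrK ltrDr.
Qed.
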